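(* Let $R$ be a division ring. Then $R$ is a $2$-$\sqrt{J}U$ ring if and only if $R\cong\mathbb{F}_2$ or $R\cong\mathbb{F}_3$.
   Context: All rings are associative with identity $1\neq 0$. For a ring $R$, $J(R)$ denotes the Jacobson radical, $U(R)$ the group of units, and $\sqrt{J(R)}=\{x\in R : x^m\in J(R)\text{ for some } m\ge 1\}$. A ring $R$ is a $2$-$\sqrt{J}U$ ring if $u^2\in 1+\sqrt{J(R)}$ for every $u\in U(R)$. $\mathbb{F}_q$ denotes the field with $q$ elements. *)

(* Defs.v *)
From mathcomp Require Import all_boot all_order all_algebra.
From mathcomp Require Import boolp classical_sets.

Set Implicit Arguments.
Unset Strict Implicit.
Unset Printing Implicit Defensive.

Import GRing.Theory.
Local Open Scope classical_set_scope.
Local Open Scope ring_scope.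

(* This is [GRing.field_axiom]; commutativity of multiplication is a separate
   structure in MathComp, and a [unitRingType] need not be commutative. *)
Definition division_ring (R : unitRingType) : Prop :=
  forall x : R, x != 0 -> x \is a GRing.unit.

(* [idealr_closed] is closure under [a * u + v] with an arbitrary left factor
   [a], together with [0 \in I] and [1 \notin I]: over a noncommutative ring it
   describes the proper *left* ideals (MathComp's header says "right"). *)
Definition proper_left_ideal (R : nzRingType) (I : set R) : Prop :=
  idealr_closed (mem I).

Definition maximal_left_ideal (R : nzRingType) (M : set R) : Prop :=
  proper_left_ideal M /\
  (forall I : set R, proper_left_ideal I -> M `<=` I -> I = M).

Definition jacobson (R : nzRingType) : set R :=
  [set x | forall M : set R, maximal_left_ideal M -> M x].
Arguments jacobson : clear implicits.

Definition sqrt_jacobson (R : nzRingType) : set R :=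
  [set x | exists2 m : nat, (1 <= m)%N & jacobson R (x ^+ m)].
Arguments sqrt_jacobson : clear implicits.

Definition two_sqrtJU (R : unitRingType) : Prop :=
  forall u : R, u \is a GRing.unit ->
    [set 1 + x | x in sqrt_jacobson R] (u ^+ 2).

Definition ring_isomorphic (R S : nzRingType) : Prop :=
  exists f : {rmorphism R -> S}, bijective f.

(* Main.v *)
Require Import Defs.
From HB Require Import structures.
From mathcomp Require Import all_boot all_order all_algebra.
From mathcomp Require Import boolp classical_sets.

(** In a division ring the zero ideal is the only proper left ideal, hence the
    only maximal one, so [J(R) = 0]; as there are no nonzero nilpotents,
    [sqrt(J(R)) = 0] as well ([sqrt_jacobson_division_ring]).  The condition
    on [R] therefore says that [u ^+ 2 = 1] for every nonzero [u]
    ([two_sqrtJU_division_ring]), that is, [(u - 1) * (u + 1) = 0], so that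
    [R = {0, 1, -1}].  If [1 + 1 = 0] then [R] has characteristic 2; otherwise
    [1 + 1 = -1] and [R] has characteristic 3.  In both cases every element is
    a natural multiple of [1], which makes [R] a copy of the prime field
    ([ring_isomorphic_Fp]).  Conversely, every nonzero element of [F_2] and of
    [F_3] squares to [1]. *)

Import GRing.Theory.
Local Open Scope ring_scope.

Lemma proper_left_ideal0 (R : nzRingType) (I : set R) :
  proper_left_ideal I -> I 0.
Proof. by case=> /set_mem. Qed.

Lemma proper_left_ideal_set1 (R : nzRingType) :
  proper_left_ideal ([set 0] : set R)%classic.
Proof.
split=> [||a u v].
- exact/mem_set.
- by apply/negP => /set_mem /eqP; rewrite oner_eq0.
- by move=> /set_mem -> /set_mem ->; apply/mem_set; rewrite /= mulr0 addr0.
Qed.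

Lemma proper_left_ideal_division_ring (R : unitRingType) (I : set R) :
  division_ring R -> proper_left_ideal I -> I = [set 0]%classic.
Proof.
move=> hR hI; apply/seteqP; split=> x /= => [Ix|->]; last first.
  exact: proper_left_ideal0.
apply: contrapT => /eqP /hR xU.
case: hI => I0 /negP I1 Ilin; apply: I1.
by rewrite -(mulVr xU) -[_ * _]addr0; apply: Ilin => //; apply/mem_set.
Qed.

Lemma jacobson0 (R : nzRingType) : jacobson R 0.
Proof. by move=> M [/proper_left_ideal0]. Qed.

Lemma jacobson_division_ring (R : unitRingType) (x : R) :
  division_ring R -> jacobson R x -> x = 0.
Proof.
move=> hR /(_ [set 0]%classic); apply; split.
  exact: proper_left_ideal_set1.
by move=> I /(proper_left_ideal_division_ring _ _ hR).
Qed.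

Lemma sqrt_jacobson_division_ring (R : unitRingType) (x : R) :
  division_ring R -> sqrt_jacobson R x <-> x = 0.
Proof.
move=> hR; split=> [[m _ /(jacobson_division_ring _ _ hR) xm0]|->].
  apply: contrapT => /eqP /hR /(unitrX m).
  by rewrite xm0 unitr0.
by exists 1%N => //; rewrite expr1; exact: jacobson0.
Qed.

Lemma two_sqrtJU_division_ring (R : unitRingType) :
  division_ring R ->
  two_sqrtJU R <-> (forall u : R, u != 0 -> u ^+ 2 = 1).
Proof.
move=> hR; split=> [h u /hR /h [x /(sqrt_jacobson_division_ring _ _ hR) -> <-]|].
  by rewrite addr0.
move=> h u uU; exists 0; first exact/(sqrt_jacobson_division_ring _ _ hR).
rewrite addr0 h //.
by apply: contraTneq uU => ->; rewrite unitr0.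
Qed.

Lemma sqr1_division_ring (R : unitRingType) (u : R) :
  division_ring R -> u ^+ 2 = 1 -> u = 1 \/ u = -1.
Proof.
move=> hR u2; have [->|/eqP] := eqVneq u 1; first by left.
move=> /eqP; rewrite -subr_eq0 => /hR uU; right.
apply/eqP; rewrite -addr_eq0 -(mulrI_eq0 _ (mulrI uU)).
by rewrite mulrDr mulr1 mulrBl mul1r -expr2 u2 addrA subrK subrr.
Qed.

Lemma eq_natr_pchar (R : nzRingType) (p m n : nat) :
  p \in [pchar R] -> (m%:R == n%:R :> R) = (m == n %[mod p]).
Proof.
move=> pR; wlog le_mn : m n / (m <= n)%N => [ih|].
  by case/orP: (leq_total m n) => /ih // e; rewrite eq_sym e eq_sym.
by rewrite [in RHS]eq_sym eqn_mod_dvd // (dvdn_pcharf pR) natrB // subr_eq0 eq_sym.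
Qed.

(** A ring of prime characteristic [p] generated by [1] as an additive group is
    the field with [p] elements: by [eq_natr_pchar] in [R] and in ['F_p], sending
    [n%:R] to [n%:R] is well defined and injective. *)
Lemma ring_isomorphic_Fp (R : nzRingType) (p : nat) :
  p \in [pchar R] -> (forall x : R, exists n : nat, x = n%:R) ->
  ring_isomorphic R 'F_p.
Proof.
move=> pR /choice [c cK].
have pF : p \in [pchar 'F_p] by rewrite pchar_Fp ?inE // (pcharf_prime pR).
(* [c x] is an arbitrary natural number with [x = (c x)%:R]; [fE] shows that
   the choice is irrelevant. *)
pose f (x : R) : 'F_p := (c x)%:R.
have fE n : f n%:R = n%:R.
  by apply/eqP; rewrite (eq_natr_pchar _ _ _ _ pF) -(eq_natr_pchar _ _ _ _ pR) -cK.
have fB : zmod_morphism f.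
  have fD x y : f (x + y) = f x + f y.
    by rewrite (cK x) (cK y) -natrD !fE natrD.
  by move=> x y; apply/eqP; rewrite eq_sym subr_eq -fD subrK.
have fM : monoid_morphism f.
  split=> [|x y]; first by rewrite -[1]/(1%:R) fE.
  by rewrite (cK x) (cK y) -natrM !fE natrM.
pose fZ := GRing.isZmodMorphism.Build _ _ f fB.
pose fR := GRing.isMonoidMorphism.Build _ _ f fM.
pose F : {rmorphism R -> 'F_p} := HB.pack f fZ fR.
exists F, (fun i : 'F_p => (i : nat)%:R) => [x|i] /=; last first.
  by rewrite fE natr_Zp.
rewrite [RHS]cK; apply/eqP.
by rewrite (eq_natr_pchar _ _ _ _ pR) -(eq_natr_pchar _ _ _ _ pF) natr_Zp.
Qed.

Lemma sqr_eq1_ring_isomorphic (R S : nzRingType) :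
  ring_isomorphic R S -> (forall v : S, v != 0 -> v ^+ 2 = 1) ->
  forall u : R, u != 0 -> u ^+ 2 = 1.
Proof.
move=> [f /bij_inj f_inj] hS u u0; apply: (f_inj).
by rewrite rmorphXn rmorph1 hS // -(rmorph0 f) (inj_eq f_inj).
Qed.

Theorem theorem2p11 (R : unitRingType) (hR : division_ring R) :
  two_sqrtJU R <-> ring_isomorphic R 'F_2 \/ ring_isomorphic R 'F_3.
Proof.
apply: (iff_trans (two_sqrtJU_division_ring _ hR)); split; last first.
  by case=> /sqr_eq1_ring_isomorphic; apply; case=> [[|[|[|]]]] // i _;
    apply/eqP.
move=> h.
have R3 (x : R) : [\/ x = 0, x = 1 | x = -1].
  have [->|/h /(sqr1_division_ring _ _ hR) [->|->]] := eqVneq x 0.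
  - exact: Or31.
  - exact: Or32.
  - exact: Or33.
have surj (n : nat) : -1 = n%:R :> R -> forall x : R, exists m, x = m%:R.
  by move=> Nn x; case: (R3 x) => ->; [exists 0%N | exists 1%N | exists n].
case: (R3 2%:R) => [two0|/eqP|twoN1].
- left; apply: ring_isomorphic_Fp; first by rewrite inE /= two0 eqxx.
  by apply: (surj 1%N); apply/esym/eqP; rewrite -addr_eq0; apply/eqP.
- by rewrite (natrD _ 1 1) -subr_eq0 addrK oner_eq0.
- right; apply: ring_isomorphic_Fp; last exact: (surj 2).
  by rewrite inE /= (natrD _ 2 1) twoN1 addNr eqxx.
Qed.
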